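(* Let $P$ be a perfect Lie superalgebra over $\mathbb{K}$, i.e. $P=[P,P]$. Let $P\otimes P$ be the non-abelian tensor product of $P$ with itself, where $P$ acts on itself by ${}^{p}p'=[p,p']$. Then the homomorphism $\mathfrak{u}\colon P\otimes P\twoheadrightarrow P$, $\mathfrak{u}(p\otimes p')=[p,p']$ (which is a central extension), is the universal central extension of $P$.
   Context: $\mathbb{K}$ is a unital commutative ring. A supermodule is a $\mathbb{K}$-module $M=M_{\bar0}\oplus M_{\bar1}$ graded by $\mathbb{Z}_2$; $|m|$ is the degree of a homogeneous element, and elements occurring in formulas with degrees are homogeneous. A linear map is even if it preserves degrees. A Lie superalgebra is a supermodule $M$ with a bilinear bracket, $[M_{\alpha},M_{\beta}]\subseteq M_{\alpha+\beta}$, such that $[x,y]=-(-1)^{|x||y|}[y,x]$ and $[x,[y,z]]=[[x,y],z]+(-1)^{|x||y|}[y,[x,z]]$ for homogeneous $x,y,z$, and $[x,x]=0$ for $x\in M_{\bar0}$. Homomorphisms are even linear maps preserving brackets. $[M,N]$ denotes the submodule spanned by the brackets $[m,n]$. An action of a Lie superalgebra $P$ on a Lie superalgebra $M$ is an even bilinear map $P\times M\to M$, $(p,m)\mapsto{}^pm$, with ${}^{[p,p']}m={}^p({}^{p'}m)-(-1)^{|p||p'|}\,{}^{p'}({}^pm)$ and ${}^p[m,m']=[{}^pm,m']+(-1)^{|p||m|}[m,{}^pm']$. Non-abelian tensor product: for Lie superalgebras $M,N$ acting on each other, $M\otimes N$ is the Lie superalgebra generated by symbols $m\otimes n$ ($m\in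 M_{\bar0}\cup M_{\bar1}$, $n\in N_{\bar0}\cup N_{\bar1}$), of degree $|m|+|n|$, subject to: (i) $\lambda(m\otimes n)=\lambda m\otimes n=m\otimes\lambda n$ for $\lambda\in\mathbb{K}$; (ii) $(m+m')\otimes n=m\otimes n+m'\otimes n$ and $m\otimes(n+n')=m\otimes n+m\otimes n'$ for $m,m'$ (resp. $n,n'$) of the same degree; (iii) $[m,m']\otimes n=m\otimes{}^{m'}n-(-1)^{|m||m'|}(m'\otimes{}^mn)$ and $m\otimes[n,n']=(-1)^{|n'|(|m|+|n|)}({}^{n'}m\otimes n)-(-1)^{|m||n|}({}^nm\otimes n')$; (iv) $[m\otimes n,m'\otimes n']=-(-1)^{|m||n|}({}^nm\otimes{}^{m'}n')$. For non-homogeneous $m,n$ the symbol $m\otimes n$ is extended bilinearly. A central extension of $P$ is a surjective homomorphism $f\colon M\twoheadrightarrow P$ of Lie superalgebras with $\operatorname{Ker}f$ contained in the centre $\{c\in M:[c,m]=0\ \forall m\in M\}$. A central extension $\mathfrak{u}\colon U\twoheadrightarrow P$ is universal if for every central extension $f\colon M\twoheadrightarrow P$ there is a unique homomorphism $\theta\colon U\to M$ with $f\circ\theta=\mathfrak{u}$. *)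

(* Defs.v *)
From HB Require Import structures.
From mathcomp Require Import all_boot all_order all_algebra.
From mathcomp Require Import boolp.

Set Implicit Arguments.
Unset Strict Implicit.
Unset Printing Implicit Defensive.

Import GRing.Theory.
Local Open Scope ring_scope.
Local Open Scope quotient_scope.

(* Degrees in Z_2 are booleans: [false] is even, [true] is odd, [a (+) b] is   *)
(* the sum and [a && b] the product of two degrees.                            *)

HB.mixin Record isSupermodule (K : pzRingType) M of GRing.Lmodule K M := {
  homog : bool -> M -> Prop ;
  homog0 : forall a, homog a 0 ;
  homog_lin : forall a (c : K) x y,
    homog a x -> homog a y -> homog a (c *: x + y) ;
  homog_split : forall x, exists2 y : bool -> M,
    forall a, homog a (y a) & x = y false + y true ;
  homog_direct : forall x, homog false x -> homog true x -> x = 0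
}.

#[short(type="supermodType")]
HB.structure Definition Supermodule (K : pzRingType) :=
  { M of isSupermodule K M & GRing.Lmodule K M }.

HB.mixin Record isLieSuperalgebra (K : pzRingType) M of Supermodule K M := {
  lie : M -> M -> M ;
  lie_linl : forall y (c : K) x x',
    lie (c *: x + x') y = c *: lie x y + lie x' y ;
  lie_linr : forall x (c : K) y y',
    lie x (c *: y + y') = c *: lie x y + lie x y' ;
  lie_homog : forall a b (x y : M),
    homog a x -> homog b y -> homog (a (+) b) (lie x y) ;
  lie_anti : forall a b (x y : M), homog a x -> homog b y ->
    lie x y = - ((-1) ^+ (a && b) *: lie y x) ;
  lie_jacobi : forall a b c (x y z : M),
    homog a x -> homog b y -> homog c z ->
    lie x (lie y z) = lie (lie x y) z + (-1) ^+ (a && b) *: lie y (lie x z) ;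
  lie_even : forall x : M, homog false x -> lie x x = 0
}.

#[short(type="lieSuperalgType")]
HB.structure Definition LieSuperalgebra (K : pzRingType) :=
  { M of isLieSuperalgebra K M & Supermodule K M }.

Section HomogTheory.
Variables (K : pzRingType) (M : supermodType K).
Implicit Types (a b : bool) (c : K) (x y : M).

Lemma homogD a x y : homog a x -> homog a y -> homog a (x + y).
Proof. by move=> hx hy; rewrite -[x]scale1r; apply: homog_lin. Qed.

Lemma homogZ a c x : homog a x -> homog a (c *: x).
Proof. by move=> hx; rewrite -[_ *: _]addr0; apply/homog_lin/homog0. Qed.

Lemma homogN a x : homog a x -> homog a (- x).
Proof. by rewrite -scaleN1r; apply: homogZ. Qed.

Definition hpart (x : M) : bool -> M := sval (cid2 (homog_split x)).

Lemma hpartP x a : homog a (hpart x a).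
Proof. by rewrite /hpart; case: cid2. Qed.

Lemma hpartE x : x = hpart x false + hpart x true.
Proof. by rewrite /hpart; case: cid2. Qed.

Lemma hpart_uniq x (y : bool -> M) : (forall a, homog a (y a)) ->
  x = y false + y true -> hpart x =1 y.
Proof.
move=> hy ex; pose d a := hpart x a - y a.
have hd a : homog a (d a) by apply/homogD/homogN/hy/hpartP.
have ed : d false = - d true.
  apply/eqP; rewrite -addr_eq0 /d addrACA -opprD -ex -hpartE; exact/eqP/subrr.
have d0 : d false = 0.
  by apply: homog_direct; [exact: hd | rewrite ed; apply/homogN/hd].
have d1 : d true = 0 by apply/eqP; rewrite -oppr_eq0 -ed d0.
by case; apply/eqP; rewrite -subr_eq0; apply/eqP.
Qed.

Lemma hpart_homog a x b : homog a x -> hpart x b = if b == a then x else 0.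
Proof.
move=> hx; pose y b := if b == a then x else 0.
apply: (@hpart_uniq x y) => [c|].
  by rewrite /y; case: eqP => [->|_] //; apply: homog0.
by rewrite /y; case: (a); rewrite ?addr0 ?add0r.
Qed.

End HomogTheory.

Section Homomorphisms.
Variables (K : pzRingType) (M P : lieSuperalgType K).

Definition is_hom (f : M -> P) : Prop :=
  [/\ linear f,
      forall a x, homog a x -> homog a (f x)
    & forall x y, f (lie x y) = lie (f x) (f y)].

Definition center (c : M) : Prop := forall m, lie c m = 0.

Definition derived (z : M) : Prop :=
  exists (n : nat) (c : 'I_n -> K) (x y : 'I_n -> M),
    z = \sum_(i < n) c i *: lie (x i) (y i).

Definition central_extension (f : M -> P) : Prop :=
  [/\ is_hom f,
      forall p, exists m, f m = p
    & forall m, f m = 0 -> center m].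

End Homomorphisms.

Definition perfect (K : pzRingType) (P : lieSuperalgType K) : Prop :=
  forall p : P, derived p.

Definition universal_central_extension (K : pzRingType)
    (U P : lieSuperalgType K) (u : U -> P) : Prop :=
  central_extension u /\
  forall (M : lieSuperalgType K) (f : M -> P), central_extension f ->
    exists theta : U -> M,
      [/\ is_hom theta, f \o theta =1 u
        & forall theta' : U -> M,
            is_hom theta' -> f \o theta' =1 u -> theta' =1 theta].

Record lieAction (K : pzRingType) (P M : lieSuperalgType K) := LieAction {
  act :> P -> M -> M ;
  act_linl : forall m (c : K) p p',
    act (c *: p + p') m = c *: act p m + act p' m ;
  act_linr : forall p (c : K) m m',
    act p (c *: m + m') = c *: act p m + act p m' ;
  act_homog : forall a b p m,
    homog a p -> homog b m -> homog (a (+) b) (act p m) ;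
  act_lie : forall a b c p p' m, homog a p -> homog b p' -> homog c m ->
    act (lie p p') m = act p (act p' m) - (-1) ^+ (a && b) *: act p' (act p m) ;
  act_der : forall a b c p m m', homog a p -> homog b m -> homog c m' ->
    act p (lie m m') = lie (act p m) m' + (-1) ^+ (a && b) *: lie m (act p m')
}.

Section Adjoint.
Variables (K : pzRingType) (P : lieSuperalgType K).

Fact adjoint_lie a b c (p p' m : P) : homog a p -> homog b p' -> homog c m ->
  lie (lie p p') m = lie p (lie p' m) - (-1) ^+ (a && b) *: lie p' (lie p m).
Proof. by move=> hp hp' hm; rewrite (lie_jacobi _ _ _ _ _ _ hp hp' hm) addrK. Qed.

Definition adjoint : lieAction P P :=
  LieAction (@lie_linl K P) (@lie_linr K P) (@lie_homog K P) adjoint_lie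
            (@lie_jacobi K P).

End Adjoint.

(* M (x) N is given by generators and relations, so it is built as the term    *)
(* model: formal expressions in the symbols m (x) n, modulo the least           *)
(* congruence [teq] containing the axioms of Lie superalgebras and the defining *)
(* relations, which are the constructors from [teq_symZl] on.                   *)

Section NonAbelianTensor.
Variables (K : comPzRingType) (M N : lieSuperalgType K).
Variables (aMN : lieAction M N) (aNM : lieAction N M).

(* A symbol records the degrees of its entries. The zero vector has both        *)
(* degrees, but [teq_symZl] and [teq_symZr] with scalar 0 make every symbol     *)
(* with a zero entry vanish, so this creates no spurious generator.             *)
Inductive tterm : Type :=
  | tsym a b (m : M) (n : N) of homog a m & homog b n
  | tzero
  | tadd of tterm & tterm
  | tscale of K & tterm
  | tlie of tterm & tterm.

Inductive tdeg : bool -> tterm -> Prop :=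
  | tdeg_sym a b m n (hm : homog a m) (hn : homog b n) :
      tdeg (a (+) b) (tsym hm hn)
  | tdeg_zero a : tdeg a tzero
  | tdeg_add a s t : tdeg a s -> tdeg a t -> tdeg a (tadd s t)
  | tdeg_scale a c t : tdeg a t -> tdeg a (tscale c t)
  | tdeg_lie a b s t : tdeg a s -> tdeg b t -> tdeg (a (+) b) (tlie s t).

Local Notation sgn k t := (tscale ((-1) ^+ nat_of_bool k) t).
Local Notation opp t := (tscale (-1) t).

Inductive teq : tterm -> tterm -> Prop :=
  | teq_refl t : teq t t
  | teq_sym s t : teq s t -> teq t s
  | teq_trans s t r : teq s t -> teq t r -> teq s r
  | teq_add s s' t t' : teq s s' -> teq t t' -> teq (tadd s t) (tadd s' t')
  | teq_scale c s s' : teq s s' -> teq (tscale c s) (tscale c s')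
  | teq_lie s s' t t' : teq s s' -> teq t t' -> teq (tlie s t) (tlie s' t')
  | teq_addA s t r : teq (tadd s (tadd t r)) (tadd (tadd s t) r)
  | teq_addC s t : teq (tadd s t) (tadd t s)
  | teq_add0 t : teq (tadd tzero t) t
  | teq_addN t : teq (tadd (opp t) t) tzero
  | teq_scaleA c d t : teq (tscale c (tscale d t)) (tscale (c * d) t)
  | teq_scale1 t : teq (tscale 1 t) t
  | teq_scaleDr c s t : teq (tscale c (tadd s t)) (tadd (tscale c s) (tscale c t))
  | teq_scaleDl c d t : teq (tscale (c + d) t) (tadd (tscale c t) (tscale d t))
  | teq_lieDl s s' t : teq (tlie (tadd s s') t) (tadd (tlie s t) (tlie s' t))
  | teq_lieDr s t t' : teq (tlie s (tadd t t')) (tadd (tlie s t) (tlie s t'))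
  | teq_lieZl c s t : teq (tlie (tscale c s) t) (tscale c (tlie s t))
  | teq_lieZr c s t : teq (tlie s (tscale c t)) (tscale c (tlie s t))
  | teq_anti a b s t : tdeg a s -> tdeg b t ->
      teq (tlie s t) (opp (sgn (a && b) (tlie t s)))
  | teq_jacobi a b c s t r : tdeg a s -> tdeg b t -> tdeg c r ->
      teq (tlie s (tlie t r))
          (tadd (tlie (tlie s t) r) (sgn (a && b) (tlie t (tlie s r))))
  | teq_even t : tdeg false t -> teq (tlie t t) tzero
  | teq_symZl c a b m n (hm : homog a m) (hn : homog b n)
      (hcm : homog a (c *: m)) :
      teq (tscale c (tsym hm hn)) (tsym hcm hn)
  | teq_symZr c a b m n (hm : homog a m) (hn : homog b n)
      (hcn : homog b (c *: n)) :
      teq (tscale c (tsym hm hn)) (tsym hm hcn)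
  | teq_symDl a b m m' n (hm : homog a m) (hm' : homog a m') (hn : homog b n)
      (hmm' : homog a (m + m')) :
      teq (tsym hmm' hn) (tadd (tsym hm hn) (tsym hm' hn))
  | teq_symDr a b m n n' (hm : homog a m) (hn : homog b n) (hn' : homog b n')
      (hnn' : homog b (n + n')) :
      teq (tsym hm hnn') (tadd (tsym hm hn) (tsym hm hn'))
  | teq_symLl a a' b m m' n
      (hm : homog a m) (hm' : homog a' m') (hn : homog b n)
      (hmm' : homog (a (+) a') (lie m m'))
      (hm'n : homog (a' (+) b) (aMN m' n)) (hmn : homog (a (+) b) (aMN m n)) :
      teq (tsym hmm' hn)
          (tadd (tsym hm hm'n) (opp (sgn (a && a') (tsym hm' hmn))))
  | teq_symLr a b b' m n n'
      (hm : homog a m) (hn : homog b n) (hn' : homog b' n')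
      (hnn' : homog (b (+) b') (lie n n'))
      (hn'm : homog (b' (+) a) (aNM n' m)) (hnm : homog (b (+) a) (aNM n m)) :
      teq (tsym hm hnn')
          (tadd (sgn (b' && (a (+) b)) (tsym hn'm hn))
                (opp (sgn (a && b) (tsym hnm hn'))))
  | teq_lie_sym a b a' b' m n m' n'
      (hm : homog a m) (hn : homog b n) (hm' : homog a' m') (hn' : homog b' n')
      (hnm : homog (b (+) a) (aNM n m)) (hm'n' : homog (a' (+) b') (aMN m' n')) :
      teq (tlie (tsym hm hn) (tsym hm' hn'))
          (opp (sgn (a && b) (tsym hnm hm'n'))).

HB.instance Definition _ := gen_eqMixin tterm.
HB.instance Definition _ := gen_choiceMixin tterm.

Definition teqb (s t : tterm) : bool := `[< teq s t >].

Fact teqb_refl : reflexive teqb.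
Proof. by move=> t; apply/asboolP/teq_refl. Qed.

Fact teqb_sym : symmetric teqb.
Proof. by move=> s t; apply/asboolP/asboolP; apply: teq_sym. Qed.

Fact teqb_trans : transitive teqb.
Proof.
by move=> t s r /asboolP st /asboolP tr; apply/asboolP/(teq_trans st tr).
Qed.

Canonical teq_equiv := EquivRel teqb teqb_refl teqb_sym teqb_trans.

Definition tensor : Type := {eq_quot teq_equiv}.

HB.instance Definition _ := Choice.on tensor.

Definition tcl (t : tterm) : tensor := \pi_{eq_quot teq_equiv} t.
Definition trep (x : tensor) : tterm := repr (x : {eq_quot teq_equiv}).

Lemma trepK : cancel trep tcl.
Proof. exact: reprK. Qed.

Lemma tclP s t : tcl s = tcl t <-> teq s t.
Proof.
split=> [/(@eqquotP _ teq_equiv {eq_quot teq_equiv})/asboolP //|st].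
by apply/(@eqquotP _ teq_equiv {eq_quot teq_equiv})/asboolP.
Qed.

Lemma trep_tcl t : teq (trep (tcl t)) t.
Proof. by apply/tclP; rewrite trepK. Qed.

Definition tensor_add (x y : tensor) := tcl (tadd (trep x) (trep y)).
Definition tensor_scale (c : K) (x : tensor) := tcl (tscale c (trep x)).
Definition tensor_lie (x y : tensor) := tcl (tlie (trep x) (trep y)).

Lemma tclD s t : tensor_add (tcl s) (tcl t) = tcl (tadd s t).
Proof. by apply/tclP/teq_add; apply: trep_tcl. Qed.

Lemma tclZ c t : tensor_scale c (tcl t) = tcl (tscale c t).
Proof. by apply/tclP/teq_scale/trep_tcl. Qed.

Lemma tclL s t : tensor_lie (tcl s) (tcl t) = tcl (tlie s t).
Proof. by apply/tclP/teq_lie; apply: trep_tcl. Qed.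

Lemma tensorW (Q : tensor -> Prop) : (forall t, Q (tcl t)) -> forall x, Q x.
Proof. by move=> Qt x; rewrite -(trepK x). Qed.

Fact tensor_addA : associative tensor_add.
Proof.
elim/tensorW=> s; elim/tensorW=> t; elim/tensorW=> r.
by rewrite !tclD; apply/tclP/teq_addA.
Qed.

Fact tensor_addC : commutative tensor_add.
Proof.
by elim/tensorW=> s; elim/tensorW=> t; rewrite !tclD; apply/tclP/teq_addC.
Qed.

Fact tensor_add0 : left_id (tcl tzero) tensor_add.
Proof. by elim/tensorW=> t; rewrite tclD; apply/tclP/teq_add0. Qed.

Fact tensor_addN : left_inverse (tcl tzero) (tensor_scale (-1)) tensor_add.
Proof. by elim/tensorW=> t; rewrite tclZ tclD; apply/tclP/teq_addN. Qed.

HB.instance Definition _ := GRing.isZmodule.Build tensor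
  tensor_addA tensor_addC tensor_add0 tensor_addN.

Fact tensor_scaleA c d x :
  tensor_scale c (tensor_scale d x) = tensor_scale (c * d) x.
Proof. by elim/tensorW: x => t; rewrite !tclZ; apply/tclP/teq_scaleA. Qed.

Fact tensor_scale1 : left_id 1 tensor_scale.
Proof. by elim/tensorW=> t; rewrite tclZ; apply/tclP/teq_scale1. Qed.

Fact tensor_scaleDr : right_distributive tensor_scale +%R.
Proof.
move=> c; elim/tensorW=> s; elim/tensorW=> t.
by rewrite /GRing.add /= !(tclD, tclZ); apply/tclP/teq_scaleDr.
Qed.

Fact tensor_scaleDl x : {morph tensor_scale^~ x : c d / c + d}.
Proof.
elim/tensorW: x => t c d.
by rewrite [RHS]/GRing.add /= !(tclD, tclZ); apply/tclP/teq_scaleDl.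
Qed.

HB.instance Definition _ := GRing.Zmodule_isLmodule.Build K tensor
  tensor_scaleA tensor_scale1 tensor_scaleDr tensor_scaleDl.

Lemma tcl0 : tcl tzero = 0. Proof. by []. Qed.

Lemma tcl_add s t : tcl (tadd s t) = tcl s + tcl t.
Proof. by rewrite -tclD. Qed.

Lemma tcl_scale c t : tcl (tscale c t) = c *: tcl t.
Proof. by rewrite -tclZ. Qed.

Fact tensor_lie_linl y (c : K) x x' :
  tensor_lie (c *: x + x') y = c *: tensor_lie x y + tensor_lie x' y.
Proof.
elim/tensorW: y => t; elim/tensorW: x => s; elim/tensorW: x' => s'.
rewrite -tcl_scale -tcl_add !tclL -tcl_scale -tcl_add; apply/tclP.
apply: teq_trans (teq_lieDl _ _ _) _.
by apply: teq_add (teq_lieZl _ _ _) (teq_refl _).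
Qed.

Fact tensor_lie_linr x (c : K) y y' :
  tensor_lie x (c *: y + y') = c *: tensor_lie x y + tensor_lie x y'.
Proof.
elim/tensorW: x => t; elim/tensorW: y => s; elim/tensorW: y' => s'.
rewrite -tcl_scale -tcl_add !tclL -tcl_scale -tcl_add; apply/tclP.
apply: teq_trans (teq_lieDr _ _ _) _.
by apply: teq_add (teq_lieZr _ _ _) (teq_refl _).
Qed.

Let lie0t y : tensor_lie 0 y = 0.
Proof. by have := tensor_lie_linl y (-1) 0 0; rewrite scaler0 add0r scaleN1r addNr. Qed.

Let liet0 x : tensor_lie x 0 = 0.
Proof. by have := tensor_lie_linr x (-1) 0 0; rewrite scaler0 add0r scaleN1r addNr. Qed.

Let lieDl x x' y : tensor_lie (x + x') y = tensor_lie x y + tensor_lie x' y.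
Proof. by rewrite -[x]scale1r tensor_lie_linl !scale1r. Qed.

Let lieDr x y y' : tensor_lie x (y + y') = tensor_lie x y + tensor_lie x y'.
Proof. by rewrite -[y]scale1r tensor_lie_linr !scale1r. Qed.

Let lieZl c x y : tensor_lie (c *: x) y = c *: tensor_lie x y.
Proof. by rewrite -[c *: x]addr0 tensor_lie_linl lie0t addr0. Qed.

Let lieZr c x y : tensor_lie x (c *: y) = c *: tensor_lie x y.
Proof. by rewrite -[c *: y]addr0 tensor_lie_linr liet0 addr0. Qed.

Fixpoint tpart (c : bool) (t : tterm) : tterm :=
  match t with
  | tsym a b _ _ _ _ => if c == a (+) b then t else tzero
  | tzero => tzero
  | tadd s t => tadd (tpart c s) (tpart c t)
  | tscale k t => tscale k (tpart c t)
  | tlie s t => tadd (tlie (tpart false s) (tpart c t))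
                     (tlie (tpart true s) (tpart (~~ c) t))
  end.

Lemma tdeg_part c t : tdeg c (tpart c t).
Proof.
elim: t c => [a b m n hm hn||s IHs t IHt|k t IHt|s IHs t IHt] c /=.
- by case: eqP => [->|_]; constructor.
- exact: tdeg_zero.
- exact: tdeg_add.
- exact: tdeg_scale.
- apply: tdeg_add; first exact: (@tdeg_lie false c).
  by rewrite -[X in tdeg X _](negbK c) -addTb; apply: tdeg_lie.
Qed.

Lemma tcl_split t : tcl t = tcl (tpart false t) + tcl (tpart true t).
Proof.
elim: t => [a b m n hm hn||s IHs t IHt|k t IHt|s IHs t IHt] /=.
- by case: (a (+) b); rewrite tcl0 ?addr0 ?add0r.
- by rewrite !tcl0 addr0.
- by rewrite !tcl_add IHs IHt addrACA.
- by rewrite !tcl_scale IHt scalerDr.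
- rewrite !tcl_add -!tclL IHs IHt lieDl !lieDr.
  by rewrite [X in _ + X = _]addrC addrACA.
Qed.

Lemma tcl_part a c t : tdeg a t ->
  tcl (tpart c t) = if c == a then tcl t else 0.
Proof.
move=> dt; elim: dt c => {a t}
  [a b m n hm hn|a|a s t _ IHs _ IHt|a k t _ IHt|a b s t _ IHs _ IHt] c /=.
- by case: eqP.
- by rewrite tcl0 if_same.
- by rewrite !tcl_add IHs IHt; case: eqP => // _; rewrite addr0.
- by rewrite !tcl_scale IHt; case: eqP => // _; rewrite scaler0.
- rewrite !tcl_add -!tclL !IHs !IHt.
  by case: a b c {IHs IHt} => [] [] [] /=; rewrite ?(lie0t, liet0, addr0, add0r).
Qed.

Let hpart_eq a c s t : tdeg a s -> tdeg a t -> teq s t ->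
  tcl (tpart c s) = tcl (tpart c t).
Proof.
by move=> ds dt /tclP e; rewrite (tcl_part _ ds) (tcl_part _ dt) e.
Qed.

Let deg_cast a b t : tdeg a t -> a = b -> tdeg b t.
Proof. by move=> ? <-. Qed.

Let deg_sym c a b m n (hm : homog a m) (hn : homog b n) :
  c = a (+) b -> tdeg c (tsym hm hn).
Proof. by move->; apply: tdeg_sym. Qed.

Let deg_lie c a b s t : tdeg a s -> tdeg b t -> a (+) b = c -> tdeg c (tlie s t).
Proof. by move=> ds dt <-; apply: tdeg_lie. Qed.

Lemma teq_part c s t : teq s t -> tcl (tpart c s) = tcl (tpart c t).
Proof.
move=> e; elim: e c => {s t}.
- by [].
- by move=> s t _ IH c; rewrite IH.
- by move=> s t r _ IH1 _ IH2 c; rewrite IH1.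
- by move=> s s' t t' _ IH1 _ IH2 c /=; rewrite !tcl_add IH1 IH2.
- by move=> k s s' _ IH c /=; rewrite !tcl_scale IH.
- by move=> s s' t t' _ IH1 _ IH2 c /=; rewrite !tcl_add -!tclL !IH1 !IH2.
- by move=> s t r c /=; apply/tclP/teq_addA.
- by move=> s t c /=; apply/tclP/teq_addC.
- by move=> t c /=; apply/tclP/teq_add0.
- by move=> t c /=; apply/tclP/teq_addN.
- by move=> k d t c /=; apply/tclP/teq_scaleA.
- by move=> t c /=; apply/tclP/teq_scale1.
- by move=> k s t c /=; apply/tclP/teq_scaleDr.
- by move=> k d t c /=; apply/tclP/teq_scaleDl.
- by move=> s s' t c /=; rewrite !tcl_add -!tclL !tcl_add !lieDl addrACA.
- by move=> s t t' c /=; rewrite !tcl_add -!tclL !tcl_add !lieDr addrACA.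
- by move=> k s t c /=; rewrite tcl_scale !tcl_add -!tclL !tcl_scale !lieZl scalerDr.
- by move=> k s t c /=; rewrite tcl_scale !tcl_add -!tclL !tcl_scale !lieZr scalerDr.
- move=> a b s t ds dt c.
  apply: (@hpart_eq (a (+) b)); last exact: teq_anti.
    exact: tdeg_lie.
  by do 2!apply: tdeg_scale; apply: deg_lie dt ds _; rewrite addbC.
- move=> a b d s t r ds dt dr c.
  apply: (@hpart_eq (a (+) (b (+) d))); last exact: teq_jacobi ds dt dr.
    by do !apply: tdeg_lie.
  apply: tdeg_add.
    by apply: deg_lie dr _; [exact: tdeg_lie ds dt | rewrite addbA].
  by apply: tdeg_scale; apply: (deg_lie dt (tdeg_lie ds dr)); rewrite addbCA.
- move=> t dt c.
  by apply: (@hpart_eq false); [exact: (deg_lie dt dt) | exact: tdeg_zero | exact: teq_even].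
- move=> k a b m n hm hn hkm c; apply: (@hpart_eq (a (+) b)); last exact: teq_symZl.
    exact/tdeg_scale/tdeg_sym.
  exact: tdeg_sym.
- move=> k a b m n hm hn hkm c; apply: (@hpart_eq (a (+) b)); last exact: teq_symZr.
    exact/tdeg_scale/tdeg_sym.
  exact: tdeg_sym.
- move=> a b m m' n hm hm' hn hmm' c.
  apply: (@hpart_eq (a (+) b)); last exact: teq_symDl.
    exact: tdeg_sym.
  by apply: tdeg_add; apply: tdeg_sym.
- move=> a b m n n' hm hn hn' hnn' c.
  apply: (@hpart_eq (a (+) b)); last exact: teq_symDr.
    exact: tdeg_sym.
  by apply: tdeg_add; apply: tdeg_sym.
- move=> a a' b m m' n hm hm' hn hmm' hm'n hmn c.
  apply: (@hpart_eq ((a (+) a') (+) b)); last exact: teq_symLl.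
    exact: tdeg_sym.
  apply: tdeg_add; first by apply: deg_sym; rewrite addbA.
  by do 2!apply: tdeg_scale; apply: deg_sym; rewrite -addbA addbCA.
- move=> a b b' m n n' hm hn hn' hnn' hn'm hnm c.
  apply: (@hpart_eq (a (+) (b (+) b'))); last exact: teq_symLr.
    exact: tdeg_sym.
  apply: tdeg_add; first by apply: tdeg_scale; apply: deg_sym;
    case: (a) (b) (b') => [] [] [].
  by do 2!apply: tdeg_scale; apply: deg_sym; case: (a) (b) (b') => [] [] [].
- move=> a b a' b' m n m' n' hm hn hm' hn' hnm hm'n' c.
  apply: (@hpart_eq ((a (+) b) (+) (a' (+) b'))); last exact: teq_lie_sym.
    by apply: tdeg_lie; apply: tdeg_sym.
  by do 2!apply: tdeg_scale; apply: deg_sym; rewrite [b (+) a]addbC.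
Qed.

Definition tensor_homog (a : bool) (x : tensor) : Prop :=
  exists2 t, tdeg a t & x = tcl t.

Fact tensor_homog0 a : tensor_homog a 0.
Proof. by exists tzero; first exact: tdeg_zero. Qed.

Fact tensor_homog_lin a (c : K) x y :
  tensor_homog a x -> tensor_homog a y -> tensor_homog a (c *: x + y).
Proof.
move=> [s ds ->] [t dt ->]; exists (tadd (tscale c s) t).
  by apply: tdeg_add => //; apply: tdeg_scale.
by rewrite tcl_add tcl_scale.
Qed.

Fact tensor_homog_split x : exists2 y : bool -> tensor,
  forall a, tensor_homog a (y a) & x = y false + y true.
Proof.
elim/tensorW: x => t; exists (fun a => tcl (tpart a t)); last exact: tcl_split.
by move=> a; exists (tpart a t); first exact: tdeg_part.
Qed.

Fact tensor_homog_direct x :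
  tensor_homog false x -> tensor_homog true x -> x = 0.
Proof.
move=> [s ds ->] [t dt /tclP/(teq_part false)].
by rewrite (tcl_part _ ds) (tcl_part _ dt).
Qed.

HB.instance Definition _ := isSupermodule.Build K tensor
  tensor_homog0 tensor_homog_lin tensor_homog_split tensor_homog_direct.

Fact tensor_lie_homog a b (x y : tensor) :
  homog a x -> homog b y -> homog (a (+) b) (tensor_lie x y).
Proof.
move=> [s ds ->] [t dt ->]; exists (tlie s t); first exact: tdeg_lie.
by rewrite tclL.
Qed.

Fact tensor_lie_anti a b (x y : tensor) : homog a x -> homog b y ->
  tensor_lie x y = - ((-1) ^+ (a && b) *: tensor_lie y x).
Proof.
move=> [s ds ->] [t dt ->]; have /tclP e := teq_anti ds dt.
by rewrite !tclL e !tcl_scale scaleN1r.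
Qed.

Fact tensor_lie_jacobi a b c (x y z : tensor) :
  homog a x -> homog b y -> homog c z ->
  tensor_lie x (tensor_lie y z) =
  tensor_lie (tensor_lie x y) z
    + (-1) ^+ (a && b) *: tensor_lie y (tensor_lie x z).
Proof.
move=> [s ds ->] [t dt ->] [r dr ->]; rewrite !tclL -tcl_scale -tcl_add.
by apply/tclP; apply: teq_jacobi dr.
Qed.

Fact tensor_lie_even (x : tensor) : homog false x -> tensor_lie x x = 0.
Proof. by move=> [s ds ->]; rewrite tclL; apply/tclP/teq_even. Qed.

HB.instance Definition _ := isLieSuperalgebra.Build K tensor
  tensor_lie_linl tensor_lie_linr tensor_lie_homog tensor_lie_anti
  tensor_lie_jacobi tensor_lie_even.

(* the bilinear extension of the symbols, see [tens_homog] *)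
Definition tens (m : M) (n : N) : tensor :=
  \sum_(a : bool) \sum_(b : bool) tcl (tsym (hpartP m a) (hpartP n b)).

Lemma tsym0l a b n (h0 : homog a 0) (hn : homog b n) : tcl (tsym h0 hn) = 0.
Proof.
have h00 : homog a (0 *: 0 : M) by apply/homogZ/homog0.
have /tclP := teq_symZl h0 hn h00.
have E (z : M) (hz : homog a z) : z = 0 -> tcl (tsym hz hn) = tcl (tsym h0 hn).
  by move=> z0; subst z; congr (tcl (tsym _ _)); apply: Prop_irrelevance.
by rewrite (E _ h00 (scaler0 _ _)) tcl_scale scale0r.
Qed.

Lemma tsym0r a b m (hm : homog a m) (h0 : homog b 0) : tcl (tsym hm h0) = 0.
Proof.
have h00 : homog b (0 *: 0 : N) by apply/homogZ/homog0.
have /tclP := teq_symZr hm h0 h00.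
have E (z : N) (hz : homog b z) : z = 0 -> tcl (tsym hm hz) = tcl (tsym hm h0).
  by move=> z0; subst z; congr (tcl (tsym _ _)); apply: Prop_irrelevance.
by rewrite (E _ h00 (scaler0 _ _)) tcl_scale scale0r.
Qed.

Lemma tens_homog a b m n (hm : homog a m) (hn : homog b n) :
  tens m n = tcl (tsym hm hn).
Proof.
have E a' b' m' n' (hm' : homog a' m') (hn' : homog b' n') :
    m' = (if a' == a then m else 0) -> n' = (if b' == b then n else 0) ->
    tcl (tsym hm' hn') =
      if (a' == a) && (b' == b) then tcl (tsym hm hn) else 0.
  case: (a' =P a) => [ea|_] em /=; last first.
    by move=> _; subst m'; rewrite tsym0l.
  case: (b' =P b) => [eb|_] en /=; last by subst n'; rewrite tsym0r.
  by subst; congr (tcl (tsym _ _)); apply: Prop_irrelevance.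
have E1 a' b' := E a' b' _ _ (hpartP m a') (hpartP n b')
  (hpart_homog _ hm) (hpart_homog _ hn).
rewrite /tens (bigD1 a) //= (bigD1 b) //= E1 !eqxx /=.
rewrite big1 => [|b' /negPf nb]; last by rewrite E1 nb andbF.
by rewrite big1 ?addr0 // => a' /negPf na; rewrite big1 // => b' _; rewrite E1 na.
Qed.

End NonAbelianTensor.

Definition tensor_square (K : comPzRingType) (P : lieSuperalgType K) :
  lieSuperalgType K := tensor (adjoint P) (adjoint P).

(* p (x) p' in P (x) P *)
Definition tsq (K : comPzRingType) (P : lieSuperalgType K) :
  P -> P -> tensor_square P := @tens K P P (adjoint P) (adjoint P).

(* Main.v *)
Require Import Defs.
From mathcomp Require Import all_boot all_order all_algebra.
From mathcomp Require Import boolp.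

(** The bracket of the tensor square satisfies [x, y] = u(x) (x) u(y), because
    relation (iv) says so on symbols and symbols span. Hence Ker u is central,
    and, u being surjective, every symbol is a bracket, so P (x) P is perfect and
    homomorphisms out of it into a central extension are unique. For existence,
    a central extension f : M -> P makes [m, n] depend only on f m and f n, which
    gives a pairing P x P -> M satisfying the defining relations of P (x) P. *)

Set Implicit Arguments.
Unset Strict Implicit.
Unset Printing Implicit Defensive.

Import GRing.Theory.
Local Open Scope ring_scope.

(** * Linear maps and homogeneous components *)

Section LinearMaps.
Variables (K : pzRingType) (U V : lmodType K) (f : U -> V).
Hypothesis lin_f : linear f.

Lemma lin0 : f 0 = 0.
Proof. by have := lin_f (-1) 0 0; rewrite scaler0 add0r scaleN1r addNr. Qed.

Lemma linD x y : f (x + y) = f x + f y.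
Proof. by rewrite -[x]scale1r lin_f !scale1r. Qed.

Lemma linZ c x : f (c *: x) = c *: f x.
Proof. by rewrite -[c *: x]addr0 lin_f lin0 addr0. Qed.

Lemma linN x : f (- x) = - f x.
Proof. by rewrite -scaleN1r linZ scaleN1r. Qed.

Lemma linB x y : f (x - y) = f x - f y.
Proof. by rewrite linD linN. Qed.

Lemma lin_sum n (F : 'I_n -> U) : f (\sum_i F i) = \sum_i f (F i).
Proof. by apply: (big_morph f linD lin0). Qed.

End LinearMaps.

Lemma hpart_lin (K : pzRingType) (M : supermodType K) c (x y : M) a :
  hpart (c *: x + y) a = c *: hpart x a + hpart y a.
Proof.
apply: (hpart_uniq (y := fun b => c *: hpart x b + hpart y b)) => [b|].
  by apply: homog_lin; apply: hpartP.
by rewrite {1}[x]hpartE {1}[y]hpartE scalerDr addrACA.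
Qed.

Lemma hom_hpart (K : pzRingType) (M P : lieSuperalgType K) (f : M -> P) :
  is_hom f -> forall m a, hpart (f m) a = f (hpart m a).
Proof.
case=> lin_f homog_f _ m; apply: (hpart_uniq (y := fun a => f (hpart m a))).
  by move=> a; apply/homog_f/hpartP.
by rewrite -(linD lin_f) -hpartE.
Qed.

(** * Bilinearity of the bracket and variants of the Jacobi identity *)

Section LieTheory.
Variables (K : pzRingType) (M : lieSuperalgType K).
Implicit Types (x y z : M).

Lemma lieDl x x' y : lie (x + x') y = lie x y + lie x' y.
Proof. exact: (linD (lie_linl y)). Qed.

Lemma lieDr x y y' : lie x (y + y') = lie x y + lie x y'.
Proof. exact: (linD (lie_linr x)). Qed.

Lemma lieZl c x y : lie (c *: x) y = c *: lie x y.
Proof. exact: (linZ (lie_linl y)). Qed.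

Lemma lieZr c x y : lie x (c *: y) = c *: lie x y.
Proof. exact: (linZ (lie_linr x)). Qed.

Lemma lieNl x y : lie (- x) y = - lie x y.
Proof. exact: (linN (lie_linl y)). Qed.

Lemma lie_jacobil a b c x y z : homog a x -> homog b y -> homog c z ->
  lie (lie x y) z = lie x (lie y z) - (-1) ^+ (a && b) *: lie y (lie x z).
Proof. by move=> hx hy hz; rewrite (lie_jacobi _ _ _ _ _ _ hx hy hz) addrK. Qed.

(** Jacobi plus antisymmetry, in the shape of the second relation (iii) for the adjoint action;
    [lie_jacobil] has the shape of the first. *)
Lemma lie_jacobir a b c x y z : homog a x -> homog b y -> homog c z ->
  lie x (lie y z) = (-1) ^+ (c && (a (+) b)) *: lie (lie z x) y
                    - (-1) ^+ (a && b) *: lie (lie y x) z.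
Proof.
move=> hx hy hz; rewrite (lie_jacobi _ _ _ _ _ _ hx hy hz) addrC.
rewrite (lie_anti _ _ _ _ hy (lie_homog _ _ _ _ hx hz)).
rewrite (lie_anti _ _ _ _ hx hz) (lie_anti _ _ _ _ hx hy).
by case: a b c {hx hy hz} => [] [] [];
  rewrite /= ?expr0 ?expr1 ?(scale1r, scaleN1r, lieNl, opprK).
Qed.

End LieTheory.

Lemma tcl_lie (K : comPzRingType) (M N : lieSuperalgType K)
    (aMN : lieAction M N) (aNM : lieAction N M) s t :
  tcl aMN aNM (tlie s t) = lie (tcl aMN aNM s) (tcl aMN aNM t).
Proof. by rewrite -tclL. Qed.

(** * Universal property of the tensor product *)

Section Lift.
Variables (K : comPzRingType) (M N L : lieSuperalgType K).
Variables (aMN : lieAction M N) (aNM : lieAction N M) (phi : M -> N -> L).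
Hypothesis phi_linl : forall n, linear (phi^~ n).
Hypothesis phi_linr : forall m, linear (phi m).
Hypothesis phi_homog : forall a b m n,
  homog a m -> homog b n -> homog (a (+) b) (phi m n).
Hypothesis phi_liel : forall a a' b m m' n,
  homog a m -> homog a' m' -> homog b n ->
  phi (lie m m') n
  = phi m (aMN m' n) - (-1) ^+ (a && a') *: phi m' (aMN m n).
Hypothesis phi_lier : forall a b b' m n n',
  homog a m -> homog b n -> homog b' n' ->
  phi m (lie n n') = (-1) ^+ (b' && (a (+) b)) *: phi (aNM n' m) n
                     - (-1) ^+ (a && b) *: phi (aNM n m) n'.
Hypothesis phi_lie : forall a b a' b' m n m' n',
  homog a m -> homog b n -> homog a' m' -> homog b' n' ->
  lie (phi m n) (phi m' n')
  = - ((-1) ^+ (a && b) *: phi (aNM n m) (aMN m' n')).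

Fixpoint teval (t : tterm M N) : L :=
  match t with
  | tsym _ _ m n _ _ => phi m n
  | tzero => 0
  | tadd s t => teval s + teval t
  | tscale c t => c *: teval t
  | tlie s t => lie (teval s) (teval t)
  end.

Lemma teval_homog a t : tdeg a t -> homog a (teval t).
Proof.
elim=> {a t} /= [a b m n hm hn|a|a s t _ hs _ ht|a c t _ ht|a b s t _ hs _ ht].
- exact: phi_homog.
- exact: homog0.
- exact: homogD.
- exact: homogZ.
- exact: lie_homog.
Qed.

(** Every constructor of [teq] is a congruence rule, an axiom that holds in [L], or a relation
    assumed of [phi]. Hence evaluation of terms descends to the quotient. *)
Lemma teval_teq s t : teq aMN aNM s t -> teval s = teval t.
Proof.
elim=> {s t} //=.
- by move=> s t r _ -> _ ->.
- by move=> s s' t t' _ -> _ ->.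
- by move=> c s s' _ ->.
- by move=> s s' t t' _ -> _ ->.
- by move=> s t r; rewrite addrA.
- by move=> s t; rewrite addrC.
- by move=> t; rewrite add0r.
- by move=> t; rewrite scaleN1r addNr.
- by move=> c d t; rewrite scalerA.
- by move=> t; rewrite scale1r.
- by move=> c s t; rewrite scalerDr.
- by move=> c d t; rewrite scalerDl.
- by move=> s s' t; rewrite lieDl.
- by move=> s t t'; rewrite lieDr.
- by move=> c s t; rewrite lieZl.
- by move=> c s t; rewrite lieZr.
- move=> a b s t /teval_homog hs /teval_homog ht.
  by rewrite scaleN1r; apply: lie_anti.
- move=> a b c s t r /teval_homog hs /teval_homog ht /teval_homog hr.
  exact: lie_jacobi hr.
- by move=> t /teval_homog; apply: lie_even.
- by move=> c a b m n *; rewrite (linZ (phi_linl n)).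
- by move=> c a b m n *; rewrite (linZ (phi_linr m)).
- by move=> a b m m' n *; rewrite (linD (phi_linl n)).
- by move=> a b m n n' *; rewrite (linD (phi_linr m)).
- by move=> a a' b m m' n hm hm' hn *; rewrite scaleN1r; apply: phi_liel hn.
- by move=> a b b' m n n' hm hn hn' *; rewrite scaleN1r; apply: phi_lier.
- by move=> a b a' b' m n m' n' hm hn hm' hn' *; rewrite scaleN1r;
    apply: phi_lie hm' hn'.
Qed.

Lemma tensor_lift : exists g : tensor aMN aNM -> L,
  is_hom g /\ forall m n, g (tens aMN aNM m n) = phi m n.
Proof.
pose g (x : tensor aMN aNM) := teval (trep x).
have gE t : g (tcl aMN aNM t) = teval t by apply/teval_teq/trep_tcl.
have lin_g : linear g.
  move=> c x y; elim/tensorW: x => s; elim/tensorW: y => t.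
  by rewrite -tcl_scale -tcl_add !gE.
exists g; split; first split=> //.
- by move=> a x [t dt ->]; rewrite gE; apply: teval_homog.
- elim/tensorW=> s; elim/tensorW=> t.
  by rewrite -tcl_lie !gE.
(* Both sides expand into four homogeneous terms; [big_bool] lists [true] first and [hpartE] lists
   [false] first, hence the commutations. *)
- move=> m n; rewrite [in RHS](hpartE m) [in RHS](hpartE n).
  rewrite (linD (phi_linl _)) !(linD (phi_linr _)) /tens !big_bool /=.
  by rewrite !(linD lin_g) !gE /= addrC; congr (_ + _); rewrite addrC.
Qed.

End Lift.

(** * Bilinearity of [tens] and induction on tensors *)

Section TensorTheory.
Variables (K : comPzRingType) (M N : lieSuperalgType K).
Variables (aMN : lieAction M N) (aNM : lieAction N M).
Local Notation tens := (tens aMN aNM).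
Local Notation tcl := (tcl aMN aNM).

Lemma tens_linl n : linear (tens^~ n).
Proof.
move=> c m m'; rewrite /tens !big_bool /= !scalerDr.
have E a b : tcl (tsym (hpartP (c *: m + m') a) (hpartP n b)) =
    c *: tcl (tsym (hpartP m a) (hpartP n b))
    + tcl (tsym (hpartP m' a) (hpartP n b)).
  (* A [tsym] carries degree proofs about its entries, which blocks rewriting them; [tens] takes
     bare vectors, so [hpart_lin] applies there. *)
  rewrite -!(tens_homog aMN aNM).
  have hc := homogZ c (hpartP m a).
  rewrite hpart_lin (tens_homog _ _ (homogD hc (hpartP m' a)) (hpartP n b)).
  rewrite !(tens_homog _ _ (hpartP _ a) (hpartP n b)) -tcl_scale.
  rewrite (proj2 (tclP _ _ _ _) (teq_symZl _ _ _ _ hc)) -tcl_add.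
  exact/tclP/teq_symDl.
by rewrite !E [RHS]addrACA; congr (_ + _); rewrite addrACA.
Qed.

Lemma tens_linr m : linear (tens m).
Proof.
move=> c n n'; rewrite /tens !big_bool /= !scalerDr.
have E a b : tcl (tsym (hpartP m a) (hpartP (c *: n + n') b)) =
    c *: tcl (tsym (hpartP m a) (hpartP n b))
    + tcl (tsym (hpartP m a) (hpartP n' b)).
  rewrite -!(tens_homog aMN aNM).
  have hc := homogZ c (hpartP n b).
  rewrite hpart_lin (tens_homog _ _ (hpartP m a) (homogD hc (hpartP n' b))).
  rewrite !(tens_homog _ _ (hpartP m a) (hpartP _ b)) -tcl_scale.
  rewrite (proj2 (tclP _ _ _ _) (teq_symZr _ _ _ _ hc)) -tcl_add.
  exact/tclP/teq_symDr.
by rewrite !E [RHS]addrACA; congr (_ + _); rewrite addrACA.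
Qed.

Lemma lie_tens_homog a b a' b' m n m' n' :
  homog a m -> homog b n -> homog a' m' -> homog b' n' ->
  lie (tens m n) (tens m' n')
  = - ((-1) ^+ (a && b) *: tens (aNM n m) (aMN m' n')).
Proof.
move=> hm hn hm' hn'.
have hnm := act_homog aNM hn hm; have hmn' := act_homog aMN hm' hn'.
rewrite (tens_homog _ _ hm hn) (tens_homog _ _ hm' hn') (tens_homog _ _ hnm hmn').
rewrite -tcl_lie (proj2 (tclP _ _ _ _) (teq_lie_sym hm hn hm' hn' hnm hmn')).
by rewrite !tcl_scale scaleN1r.
Qed.

(* The bracket of two symbols is a multiple of a symbol, so linear closure
   alone suffices. *)
Lemma tensor_ind (Q : tensor aMN aNM -> Prop) :
    Q 0 -> (forall c x y, Q x -> Q y -> Q (c *: x + y)) ->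
    (forall a b m n, homog a m -> homog b n -> Q (tens m n)) ->
  forall x, Q x.
Proof.
move=> Q0 Qlin Qtens; elim/tensorW=> t.
(* [Q] is generalized because the bracket case uses the induction hypotheses for the predicates [Q
   [-, t]] and [Q [m (x) n, -]], which are again closed under linear combinations. *)
elim: t Q Q0 Qlin Qtens
  => [a b m n hm hn||s IHs t IHt|c t IHt|s IHs t IHt] Q Q0 Qlin Qtens.
- by rewrite -(tens_homog aMN aNM hm hn); apply: Qtens hm hn.
- exact: Q0.
- by rewrite tcl_add -[tcl s]scale1r; apply: (Qlin); [apply: IHs | apply: IHt].
- by rewrite tcl_scale -[_ *: _]addr0; apply: (Qlin); first apply: IHt.
- rewrite tcl_lie.
  apply: (IHs (fun x => Q (lie x (tcl t)))) => [|c x y|a b m n hm hn].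
  + by rewrite (lin0 (lie_linl _)).
  + by rewrite lie_linl; apply: (Qlin).
  apply: (IHt (fun y => Q (lie (tens m n) y))) => [|c x y|a' b' m' n' hm' hn'].
  + by rewrite (lin0 (lie_linr _)).
  + by rewrite lie_linr; apply: (Qlin).
  rewrite (lie_tens_homog hm hn hm' hn') -scaleNr -[_ *: _]addr0.
  by apply: Qlin (Q0); apply: Qtens (act_homog _ hn hm) (act_homog _ hm' hn').
Qed.

End TensorTheory.

(** * The homomorphism [u] on the tensor square *)

Section TensorSquare.
Variables (K : comPzRingType) (P : lieSuperalgType K).

Lemma tsq_linl (p' : P) : linear (fun p : P => tsq p p').
Proof. exact: tens_linl. Qed.

Lemma tsq_linr (p : P) : linear (fun p' : P => tsq p p').
Proof. exact: tens_linr. Qed.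

Variable u : tensor_square P -> P.
Hypotheses (hom_u : is_hom u) (uE : forall p p', u (tsq p p') = lie p p').

Lemma lie_tensor_square x y : lie x y = tsq (u x) (u y).
Proof.
have [lin_u _ _] := hom_u.
elim/tensor_ind: x => [|c x x' IHx IHx'|a b m n hm hn].
- by rewrite (lin0 lin_u) (lin0 (lie_linl y)) (lin0 (tsq_linl _)).
- by rewrite lin_u lie_linl IHx IHx' tsq_linl.
elim/tensor_ind: y => [|c y y' IHy IHy'|a' b' m' n' hm' hn'].
- by rewrite (lin0 lin_u) (lin0 (lie_linr _)) (lin0 (tsq_linr _)).
- by rewrite lin_u lie_linr IHy IHy' tsq_linr.
(* Antisymmetry turns [[m, n]] into [[n, m]] with exactly the sign that relation (iv) carries. *)
rewrite -/(tsq m n) -/(tsq m' n') !uE (lie_anti _ _ _ _ hm hn).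
rewrite -scaleNr (linZ (tsq_linl _)) scaleNr.
exact: lie_tens_homog hm hn hm' hn'.
Qed.

Lemma tensor_square_surj : perfect P -> forall p, exists x, u x = p.
Proof.
have [lin_u _ _] := hom_u => perfP p; have [n [c [x [y ->]]]] := perfP p.
exists (\sum_(i < n) c i *: tsq (x i) (y i)); rewrite (lin_sum lin_u).
by apply: eq_bigr => i _; rewrite (linZ lin_u) uE.
Qed.

Lemma tensor_square_central : perfect P -> central_extension u.
Proof.
move=> perfP; split; [exact: hom_u | exact: tensor_square_surj |].
by move=> x ux0 y; rewrite lie_tensor_square ux0 (lin0 (tsq_linl _)).
Qed.

End TensorSquare.

(** * Brackets in a central extension *)

Section CentralExtension.
Variables (K : comPzRingType) (M P : lieSuperalgType K) (f : M -> P).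
Hypothesis cext_f : central_extension f.

Let hom_f : is_hom f. Proof. by case: cext_f. Qed.
Let lin_f : linear f. Proof. by case: hom_f. Qed.
Let fL x y : f (lie x y) = lie (f x) (f y). Proof. by case: hom_f. Qed.
Let surj_f p : exists m, f m = p. Proof. by case: cext_f => _ /(_ p). Qed.
Let ker_f c m : f c = 0 -> lie c m = 0. Proof. by case: cext_f => _ _ h /h. Qed.

(** [center] only gives [[c, m] = 0]. The other side follows by antisymmetry on homogeneous
    components, and those of [c] stay in the kernel because [f] is even. *)
Lemma lie_ker_r c m : f c = 0 -> lie m c = 0.
Proof.
move=> fc0; have part0 a b : lie (hpart m a) (hpart c b) = 0.
  rewrite (lie_anti _ _ _ _ (hpartP m a) (hpartP c b)) ker_f ?scaler0 ?oppr0 //.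
  by rewrite -(hom_hpart hom_f) fc0 (hpart_homog _ (homog0 false)) if_same.
by rewrite (hpartE m) (hpartE c) lieDl !lieDr !part0 !addr0.
Qed.

Lemma lie_fiber m m' n n' : f m = f m' -> f n = f n' -> lie m n = lie m' n'.
Proof.
move=> em en; transitivity (lie m' n).
  apply/eqP; rewrite -subr_eq0 -(linB (lie_linl n)); apply/eqP/ker_f.
  by rewrite (linB lin_f) em subrr.
apply/eqP; rewrite -subr_eq0 -(linB (lie_linr m')); apply/eqP/lie_ker_r.
by rewrite (linB lin_f) en subrr.
Qed.

(** Since [f] commutes with taking components, the degree [a] component of any preimage of [p] is
    still a preimage. *)
Lemma homog_lift a p : homog a p -> exists2 m, homog a m & f m = p.
Proof.
move=> hp; have [m fm] := surj_f p; exists (hpart m a); first exact: hpartP.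
by rewrite -(hom_hpart hom_f) fm (hpart_homog _ hp) eqxx.
Qed.

Lemma bracket_lift : exists theta : tensor_square P -> M,
  is_hom theta /\ forall m n, theta (tsq (f m) (f n)) = lie m n.
Proof.
(* The section [s] is an arbitrary choice, neither linear nor even; [phi] is nevertheless bilinear
   and even, because [phiE] allows any preimages in place of the chosen ones. *)
pose s p := sval (cid (surj_f p)).
have sK p : f (s p) = p by rewrite /s; case: cid.
pose phi p q := lie (s p) (s q).
have phiE m n : phi (f m) (f n) = lie m n by apply: lie_fiber.
suff [g [hom_g gE]] : exists g : tensor_square P -> M,
    is_hom g /\ forall p q, g (tsq p q) = phi p q.
  by exists g; split=> // m n; rewrite gE.
apply: tensor_lift => /=.
- move=> q c p p'; rewrite -(sK p) -(sK p') -(sK q) -lin_f !phiE.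
  exact: lie_linl.
- move=> p c q q'; rewrite -(sK p) -(sK q) -(sK q') -lin_f !phiE.
  exact: lie_linr.
(* From here on arguments are replaced by homogeneous preimages, so each condition on [phi] becomes
   an identity between brackets in [M]. *)
- move=> a b _ _ /homog_lift[m hm <-] /homog_lift[n hn <-].
  by rewrite phiE; apply: lie_homog.
- move=> a a' b _ _ _ /homog_lift[m hm <-] /homog_lift[m' hm' <-]
    /homog_lift[n hn <-]; rewrite -!fL !phiE.
  exact: lie_jacobil hn.
- move=> a b b' _ _ _ /homog_lift[m hm <-] /homog_lift[n hn <-]
    /homog_lift[n' hn' <-]; rewrite -!fL !phiE.
  exact: lie_jacobir.
- move=> a b a' b' _ _ _ _ /homog_lift[m hm <-] /homog_lift[n hn <-]
    /homog_lift[m' hm' <-] /homog_lift[n' hn' <-]; rewrite -!fL !phiE.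
  by rewrite (lie_anti _ _ _ _ hm hn) lieNl lieZl.
Qed.

End CentralExtension.

Theorem theorem4p1 (K : comPzRingType) (P : lieSuperalgType K)
    (hP : perfect P) :
  (exists u : tensor_square P -> P,
      is_hom u /\ forall p p' : P, u (tsq p p') = lie p p') /\
  (forall u : tensor_square P -> P,
      is_hom u -> (forall p p' : P, u (tsq p p') = lie p p') ->
      universal_central_extension u).
Proof.
split.
  (* For the identity extension, the map given by [bracket_lift] is [u] itself. *)
  have cext_id : central_extension (@id P).
    by split=> [|p|m ->]; [split | exists p | move=> n; apply: (lin0 (lie_linl n))].
  exact: (bracket_lift cext_id).
move=> u hom_u uE; split; first exact: tensor_square_central.
move=> M f cext_f; have [[lin_f _ fL] surj_f _] := cext_f.
have [lin_u _ _] := hom_u.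
have [theta [hom_theta thetaE]] := bracket_lift cext_f.
have [lin_theta _ thetaL] := hom_theta.
exists theta; split=> //.
  elim/tensor_ind=> [|c x y /= IHx IHy|a b p q _ _] /=.
  - by rewrite (lin0 lin_theta) (lin0 lin_f) (lin0 lin_u).
  - by rewrite lin_theta lin_f lin_u IHx IHy.
  (* On a symbol, both sides equal [[f m, f n]]. *)
  have [[m <-] [n <-]] := (surj_f p, surj_f q).
  by rewrite -/(tsq _ _) thetaE uE fL.
move=> theta' [lin_theta' _ theta'L] ftheta'.
elim/tensor_ind=> [|c x y IHx IHy|a b p q _ _].
- by rewrite (lin0 lin_theta) (lin0 lin_theta').
- by rewrite lin_theta lin_theta' IHx IHy.
(* Perfectness makes [p (x) q] the bracket [[x, y]], so [theta'] sends it to [[theta' x, theta' y]].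
   As [theta' x] and [m] both lie over [p], and [theta' y] and [n] over [q], this is [[m, n]], the
   value of [theta]. *)
have [[x ux] [y uy]] :=
  (tensor_square_surj hom_u uE hP p, tensor_square_surj hom_u uE hP q).
have [[m fm] [n fn]] := (surj_f p, surj_f q).
rewrite -/(tsq p q) -{1}ux -{1}uy -(lie_tensor_square hom_u uE) theta'L.
rewrite -fm -fn thetaE; apply: (lie_fiber cext_f).
  by rewrite fm -ux -ftheta'.
by rewrite fn -uy -ftheta'.
Qed.
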